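(* Let $G=(V,E)$ be a finite undirected simple unweighted $D$-regular graph with a signature $\sigma:E^{or}\to H$, where $H=O(d)$ or $H=U(d)$, and let $K\in\mathbb{R}$. Assume that $G$ with $\sigma$ satisfies $CD^\sigma(K,\infty)$. Then the first (i.e. smallest) nonzero eigenvalue $\lambda^\sigma$ of the connection Laplacian satisfies $$\lambda^\sigma\ge K .$$
   Context: Let $D\ge1$. Put $\mathbb{K}=\mathbb{R}$ if $H=O(d)$ and $\mathbb{K}=\mathbb{C}$ if $H=U(d)$. Write $x\sim y$ if $\{x,y\}\in E$, and $E^{or}=\{(x,y),(y,x)\mid\{x,y\}\in E\}$. A signature is a map $\sigma:E^{or}\to H$ with $\sigma_{yx}=\sigma_{xy}^{-1}$. For $u:V\to\mathbb{K}$, $\Delta u(x)=\frac1D\sum_{y\sim x}(u(y)-u(x))$; for $f:V\to\mathbb{K}^d$, $\Delta^\sigma f(x)=\frac1D\sum_{y\sim x}(\sigma_{xy}f(y)-f(x))$. Eigenvalues of the connection Laplacian mean eigenvalues of $-\Delta^\sigma$ (all are real and nonnegative). Define $2\Gamma^\sigma(f,g)=\Delta(f^T\overline g)-f^T(\overline{\Delta^\sigma g})-(\Delta^\sigma f)^T\overline g$ and $2\Gamma_2^\sigma(f,g)=\Delta\Gamma^\sigma(f,g)-\Gamma^\sigma(f,\Delta^\sigma g)-\Gamma^\sigma(\Delta^\sigma f,g)$. $CD^\sigma(K,\infty)$ means $\Gamma_2^\sigma(f,f)(x)\ge K\,\Gamma^\sigma(f,f)(x)$ for all $f:V\to\mathbb{K}^d$,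 $x\in V$. *)

(* Defs.v *)
From HB Require Import structures.
From mathcomp Require Import all_boot all_order all_algebra.
From mathcomp Require Import spectral.
From mathcomp Require Import complex.
From mathcomp Require Import reals.

Set Implicit Arguments.
Unset Strict Implicit.
Unset Printing Implicit Defensive.

Import Order.TTheory GRing.Theory Num.Theory.
Local Open Scope ring_scope.

(* A simple graph on the finite type V is a symmetric irreflexive relation e,
   e x y meaning {x,y} is an edge. *)
Definition simple_graph (V : finType) (e : rel V) : Prop :=
  symmetric e /\ irreflexive e.

Definition regular_graph (V : finType) (e : rel V) (D : nat) : Prop :=
  forall x : V, #|[set y | e x y]| = D.

Definition orthogonalmx (K : comNzRingType) (d : nat) : {pred 'M[K]_d} :=
  fun A => A *m A^T == 1%:M.

(* Only the values of s on oriented edges matter: the values s x y with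
   ~~ e x y are junk and are never used below. *)
Definition signature (K : fieldType) (V : finType) (e : rel V) (d : nat)
    (H : {pred 'M[K]_d}) (s : V -> V -> 'M[K]_d) : Prop :=
  forall x y : V, e x y -> s x y \in H /\ s y x = invmx (s x y).

Definition laplacian (K : fieldType) (V : finType) (e : rel V) (D : nat)
    (u : {ffun V -> K}) : {ffun V -> K} :=
  [ffun x => D%:R^-1 * \sum_(y | e x y) (u y - u x)].

Definition conn_laplacian (K : fieldType) (V : finType) (e : rel V) (D d : nat)
    (s : V -> V -> 'M[K]_d) (f : {ffun V -> 'cV[K]_d}) :
    {ffun V -> 'cV[K]_d} :=
  [ffun x => D%:R^-1 *: \sum_(y | e x y) (s x y *m f y - f x)].

Definition neg_conn_laplacian (K : fieldType) (V : finType) (e : rel V)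
    (D d : nat) (s : V -> V -> 'M[K]_d) (f : {ffun V -> 'cV[K]_d}) :
    {ffun V -> 'cV[K]_d} :=
  - conn_laplacian e D s f.

Lemma neg_conn_laplacian_is_linear (K : fieldType) (V : finType) (e : rel V)
    (D d : nat) (s : V -> V -> 'M[K]_d) :
  linear (@neg_conn_laplacian K V e D d s).
Proof.
move=> a f g; apply/ffunP => x; rewrite !ffunE.
rewrite scalerN scalerA mulrC -scalerA -opprD -scalerDr; congr (- (_ *: _)).
rewrite scaler_sumr -big_split /=; apply: eq_bigr => y _.
by rewrite !ffunE mulmxDr -scalemxAr scalerBr opprD addrACA.
Qed.

HB.instance Definition _ (K : fieldType) (V : finType) (e : rel V)
    (D d : nat) (s : V -> V -> 'M[K]_d) :=
  GRing.isLinear.Build K {ffun V -> 'cV[K]_d} {ffun V -> 'cV[K]_d} *:%R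
    (@neg_conn_laplacian K V e D d s)
    (@neg_conn_laplacian_is_linear K V e D d s).

(* f^T gbar, for the conjugation cj of K: the identity when K is the field of
   real numbers, complex conjugation when K is the field of complex numbers. *)
Definition herm (K : fieldType) (cj : K -> K) (V : finType) (d : nat)
    (f g : {ffun V -> 'cV[K]_d}) : {ffun V -> K} :=
  [ffun x => ((f x)^T *m map_mx cj (g x)) 0 0].

Definition Gamma (K : fieldType) (cj : K -> K) (V : finType) (e : rel V)
    (D d : nat) (s : V -> V -> 'M[K]_d) (f g : {ffun V -> 'cV[K]_d}) :
    {ffun V -> K} :=
  [ffun x => 2%:R^-1 * (laplacian e D (herm cj f g) x
                        - herm cj f (conn_laplacian e D s g) x
                        - herm cj (conn_laplacian e D s f) g x)].

Definition Gamma2 (K : fieldType) (cj : K -> K) (V : finType) (e : rel V)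
    (D d : nat) (s : V -> V -> 'M[K]_d) (f g : {ffun V -> 'cV[K]_d}) :
    {ffun V -> K} :=
  [ffun x => 2%:R^-1 * (laplacian e D (Gamma cj e D s f g) x
                        - Gamma cj e D s f (conn_laplacian e D s g) x
                        - Gamma cj e D s (conn_laplacian e D s f) g x)].

(* In the complex case a <= b means that b - a is a nonnegative real number;
   for a signature in O(d) or U(d) and real k, both sides below are real. *)
Definition CD_infty (K : numFieldType) (cj : K -> K) (V : finType) (e : rel V)
    (D d : nat) (s : V -> V -> 'M[K]_d) (k : K) : Prop :=
  forall (f : {ffun V -> 'cV[K]_d}) (x : V),
    k * Gamma cj e D s f f x <= Gamma2 cj e D s f f x.

Definition conn_eigenvalue (K : fieldType) (V : finType) (e : rel V)
    (D d : nat) (s : V -> V -> 'M[K]_d) (a : K) : bool :=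
  passmx.leigenvalue (linfun (@neg_conn_laplacian K V e D d s)) a.

Definition first_nonzero_eigenvalue (K : numFieldType) (V : finType)
    (e : rel V) (D d : nat) (s : V -> V -> 'M[K]_d) (a : K) : Prop :=
  [/\ conn_eigenvalue e D s a, a != 0 &
      forall b : K, conn_eigenvalue e D s b -> b != 0 -> a <= b].

(* Main.v *)
Require Import Defs.
From HB Require Import structures.
From mathcomp Require Import all_boot all_order all_algebra.
From mathcomp Require Import spectral.
From mathcomp Require Import complex.
From mathcomp Require Import reals.
From mathcomp Require Import ring.

Set Implicit Arguments.
Unset Strict Implicit.
Unset Printing Implicit Defensive.

Import Order.TTheory GRing.Theory Num.Theory.
Local Open Scope ring_scope.
Local Open Scope complex_scope.

(** The idea is to sum the curvature inequality over all vertices, applied to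
    an eigenfunction. Let [f] satisfy [- Delta f = a f] with [a != 0], and
    write [N] for the sum over all [x] of the squared norms of [f x].

    The scalar Laplacian of any function sums to zero on a finite graph
    ([sum_laplacian]), so only the cross terms of the two carre du champ
    operators survive summation. As the connection Laplacian is self-adjoint
    ([conn_laplacian_self_adjoint]), [a] is fixed by conjugation, and the cross
    terms evaluate to: the sum of [Gamma f f] is [a * N], and the sum of
    [Gamma2 f f] is [a * (a * N)]. Summing the curvature-dimension inequality
    therefore gives [k * (a * N) <= a * (a * N)].

    It remains to cancel [a * N], i.e. to know that it is positive. Since the
    connection acts by isometries, [Gamma f f x] is half the average of the
    squared norms of [s x y *m f y - f x] over the neighbours [y] of [x]
    ([GammaE]); hence [a * N], being a sum of such terms, is nonnegative, and it
    is nonzero because both [a] and [f] are. The argument bounds every nonzero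
    eigenvalue from below, in particular the first one.

    The orthogonal and the unitary case are treated at once, over a field with
    an involutive automorphism [cj] such that every [a * cj a] is nonnegative:
    [cj] is the identity in the first case, conjugation in the second. *)

Section HermitianForm.

Context (K : numFieldType) (cj : {rmorphism K -> K}).
Hypothesis cjK : involutive cj.

Definition dotc (d : nat) (u v : 'cV[K]_d) : K := (u^T *m map_mx cj v) 0 0.

Section FixedDimension.

Context (d : nat).
Implicit Types u v w : 'cV[K]_d.

Lemma dotcE u v : dotc u v = \sum_i u i 0 * cj (v i 0).
Proof. by rewrite /dotc mxE; apply: eq_bigr => i _; rewrite !mxE. Qed.

Lemma dotcZl a u v : dotc (a *: u) v = a * dotc u v.
Proof. by rewrite /dotc linearZ /= -scalemxAl mxE. Qed.

Lemma dotcZr a u v : dotc u (a *: v) = cj a * dotc u v.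
Proof. by rewrite /dotc map_mxZ -scalemxAr mxE. Qed.

Lemma dotcBl u v w : dotc (u - v) w = dotc u w - dotc v w.
Proof. by rewrite /dotc linearB /= mulmxBl !mxE. Qed.

Lemma dotcBr u v w : dotc w (u - v) = dotc w u - dotc w v.
Proof. by rewrite /dotc map_mxB mulmxBr !mxE. Qed.

Lemma dotc_suml (I : finType) (P : pred I) (F : I -> 'cV[K]_d) w :
  dotc (\sum_(i | P i) F i) w = \sum_(i | P i) dotc (F i) w.
Proof. by rewrite /dotc linear_sum mulmx_suml summxE. Qed.

Lemma dotc_sumr (I : finType) (P : pred I) (F : I -> 'cV[K]_d) w :
  dotc w (\sum_(i | P i) F i) = \sum_(i | P i) dotc w (F i).
Proof. by rewrite /dotc raddf_sum mulmx_sumr summxE. Qed.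

(** Moving a unitary matrix across the form inverts it. As a signature satisfies
    [s y x = invmx (s x y)], this turns the transport along an edge into the
    transport along the reversed edge. *)
Lemma dotc_adjoint (A : 'M[K]_d) u v :
  A *m (map_mx cj A)^T = 1%:M -> dotc (A *m u) v = dotc u (invmx A *m v).
Proof.
move=> uA; have [Aunit _] := mulmx1_unit uA.
have -> : invmx A = (map_mx cj A)^T by rewrite -[RHS](mulKmx Aunit) uA mulmx1.
rewrite /dotc trmx_mul map_mxM -mulmxA; congr ((_ *m (_ *m _)) 0 0).
by apply/matrixP=> i j; rewrite !mxE cjK.
Qed.

Lemma dotc_isometry (A : 'M[K]_d) u :
  A *m (map_mx cj A)^T = 1%:M -> dotc (A *m u) (A *m u) = dotc u u.
Proof.
by move=> uA; rewrite dotc_adjoint// mulKmx//; have [] := mulmx1_unit uA.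
Qed.

Hypothesis cj_ge0 : forall a : K, 0 <= a * cj a.

Lemma dotc_ge0 u : 0 <= dotc u u.
Proof. by rewrite dotcE sumr_ge0. Qed.

Lemma dotc_eq0 u : dotc u u = 0 -> u = 0.
Proof.
rewrite dotcE => /eqP; rewrite psumr_eq0// => /allP u0.
apply/colP => i; rewrite mxE; have := u0 i (mem_index_enum i).
by rewrite mulf_eq0 fmorph_eq0 orbb => /eqP.
Qed.

End FixedDimension.

Context (V : finType) (e : rel V) (D d : nat) (s : V -> V -> 'M[K]_d).
Implicit Types f g : {ffun V -> 'cV[K]_d}.

Local Notation Delta := (conn_laplacian e D s).

Definition l2form f g : K := \sum_x herm cj f g x.

Lemma hermE f g x : herm cj f g x = dotc (f x) (g x).
Proof. by rewrite ffunE. Qed.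

Lemma l2formZl a f g : l2form (a *: f) g = a * l2form f g.
Proof.
by rewrite mulr_sumr; apply: eq_bigr => x _; rewrite !hermE ffunE dotcZl.
Qed.

Lemma l2formZr a f g : l2form f (a *: g) = cj a * l2form f g.
Proof.
by rewrite mulr_sumr; apply: eq_bigr => x _; rewrite !hermE ffunE dotcZr.
Qed.

Hypothesis esym : symmetric e.

(** Reversal is a bijection of the oriented edges; every summation by parts below
    rests on it. *)
Lemma sum_edges_swap (F : V -> V -> K) :
  \sum_x \sum_(y | e x y) F x y = \sum_x \sum_(y | e x y) F y x.
Proof.
rewrite (exchange_big_dep xpredT)//=; apply: eq_bigr => x _.
by apply: eq_bigl => y; rewrite esym.
Qed.

Lemma sum_laplacian (u : {ffun V -> K}) : \sum_x laplacian e D u x = 0.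
Proof.
under eq_bigr do rewrite ffunE sumrB mulrBr.
rewrite sumrB -!mulr_sumr [X in _ * X - _]sum_edges_swap.
exact: subrr.
Qed.

(** The leading Laplacian term in the definition of [Gamma] contributes nothing
    to the sum; the same reason gives [sum_Gamma2] below. *)
Lemma sum_Gamma f g :
  \sum_x Gamma cj e D s f g x =
  - (2%:R^-1 * (l2form f (Delta g) + l2form (Delta f) g)).
Proof.
under eq_bigr do rewrite ffunE.
by rewrite -mulr_sumr !sumrB sum_laplacian sub0r -opprD mulrN.
Qed.

Lemma sum_Gamma2 f g :
  \sum_x Gamma2 cj e D s f g x =
  - (2%:R^-1 * (\sum_x Gamma cj e D s f (Delta g) x
                + \sum_x Gamma cj e D s (Delta f) g x)).
Proof.
under eq_bigr do rewrite ffunE.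
by rewrite -mulr_sumr !sumrB sum_laplacian sub0r -opprD mulrN.
Qed.

Hypothesis sH : signature e [pred A | A *m (map_mx cj A)^T == 1%:M] s.

(** Both sides are sums over oriented edges, and reversing the edges matches
    the transport terms, since [s y x] is the adjoint of [s x y]. *)
Lemma conn_laplacian_self_adjoint f g :
  l2form (Delta f) g = l2form f (Delta g).
Proof.
have cjD : cj D%:R^-1 = D%:R^-1 by rewrite fmorphV rmorph_nat.
rewrite /l2form; under eq_bigr do rewrite hermE ffunE dotcZl dotc_suml.
under [RHS]eq_bigr do rewrite hermE ffunE dotcZr dotc_sumr cjD.
rewrite -!mulr_sumr; congr (_ * _).
under eq_bigr do under eq_bigr do rewrite dotcBl.
under [RHS]eq_bigr do under eq_bigr do rewrite dotcBr.
under eq_bigr do rewrite sumrB.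
under [RHS]eq_bigr do rewrite sumrB.
rewrite !sumrB; congr (_ - _); rewrite [RHS]sum_edges_swap.
apply: eq_bigr => x _; apply: eq_bigr => y exy.
by have [/eqP uxy ->] := sH exy; rewrite dotc_adjoint.
Qed.

(** Expanding the squared norm of the covariant difference along an edge gives
    the terms of [Gamma], once the norm of [s x y *m f y] is replaced with that
    of [f y]; the latter step needs the transport to be isometric. *)
Lemma GammaE f x :
  Gamma cj e D s f f x = 2%:R^-1 * (D%:R^-1 *
    \sum_(y | e x y) dotc (s x y *m f y - f x) (s x y *m f y - f x)).
Proof.
have cjD : cj D%:R^-1 = D%:R^-1 by rewrite fmorphV rmorph_nat.
rewrite ffunE; congr (_ * _); rewrite !hermE !ffunE dotcZl dotcZr cjD -!mulrBr.
congr (_ * _); rewrite dotc_suml dotc_sumr -!sumrB.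
apply: eq_bigr => y exy; have [/eqP uxy _] := sH exy.
rewrite !hermE !(dotcBl, dotcBr) dotc_isometry//.
by rewrite -/(dotc (f x) (f x)); ring.
Qed.

Hypothesis cj_ge0 : forall a : K, 0 <= a * cj a.

Lemma Gamma_ge0 f x : 0 <= Gamma cj e D s f f x.
Proof.
rewrite GammaE !mulr_ge0 ?invr_ge0 ?ler0n// sumr_ge0// => y _.
exact: dotc_ge0.
Qed.

Lemma l2form_gt0 f : f != 0 -> 0 < l2form f f.
Proof.
have ge0 x : 0 <= herm cj f f x by rewrite hermE dotc_ge0.
rewrite lt_def sumr_ge0// andbT; apply: contra_neq => /eqP.
rewrite psumr_eq0// => /allP f0; apply/ffunP => x; rewrite ffunE.
by have /eqP := f0 x (mem_index_enum x); rewrite hermE; apply: dotc_eq0.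
Qed.

Lemma conn_eigenvalueP a :
  conn_eigenvalue e D s a -> exists2 f, f != 0 & Delta f = - a *: f.
Proof.
rewrite /conn_eigenvalue /passmx.leigenvalue -vpick0.
set f := vpick _ => fn0; exists f => //.
have := memv_pick (passmx.leigenspace (linfun (neg_conn_laplacian e D s)) a).
rewrite -/f memv_ker add_lfunE opp_lfunE scale_lfunE id_lfunE lfunE /=.
rewrite subr_eq0 /neg_conn_laplacian => /eqP fE.
by rewrite scaleNr -fE opprK.
Qed.

(** The Lichnerowicz argument: sum the curvature-dimension inequality for an
    eigenfunction and cancel the total energy, which is [a] times its squared
    norm. *)
Lemma conn_eigenvalue_lower_bound (k a : K) :
  CD_infty cj e D s k -> conn_eigenvalue e D s a -> a != 0 -> k <= a.
Proof.
move=> cd /conn_eigenvalueP [f fn0 fE] an0.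
have N0 := l2form_gt0 fn0.
(* Self-adjointness equates [- a] and [- cj a] as multiples of a nonzero
   number. *)
have areal : cj a = a.
  have := conn_laplacian_self_adjoint f f.
  rewrite fE l2formZl l2formZr rmorphN.
  by move=> /(mulIf (lt0r_neq0 N0)) /oppr_inj.
have half (c : K) : 2%:R^-1 * (c + c) = c.
  by field.
have EG : \sum_x Gamma cj e D s f f x = a * l2form f f.
  by rewrite sum_Gamma fE l2formZl l2formZr rmorphN areal half mulNr opprK.
have EG2 : \sum_x Gamma2 cj e D s f f x = a * (a * l2form f f).
  rewrite sum_Gamma2 !sum_Gamma.
  (* Self-adjointness brings all four terms to the squared norm of [Delta f]. *)
  rewrite [l2form (Delta (Delta f)) f]conn_laplacian_self_adjoint.
  rewrite -[l2form f (Delta (Delta f))]conn_laplacian_self_adjoint.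
  rewrite fE l2formZl l2formZr rmorphN areal half.
  by field.
have aN0 : 0 < a * l2form f f.
  rewrite lt_def mulf_neq0 ?(lt0r_neq0 N0)//= -EG.
  by rewrite sumr_ge0// => x _; apply: Gamma_ge0.
(* Multiplied by [a * l2form f f], the claim is the inequality between the sums
   of [k * Gamma f f] and [Gamma2 f f]. *)
rewrite -(ler_pM2r aN0) -EG2 -EG mulr_sumr.
by apply: ler_sum => x _; apply: cd.
Qed.

End HermitianForm.

Theorem theorem1p6 (R : realType) (V : finType) (e : rel V) (D d : nat)
    (k : R) (HD : (1 <= D)%N) (He : simple_graph e)
    (Hreg : regular_graph e D) :
  (forall s : V -> V -> 'M[R]_d,
     signature e (@orthogonalmx R d) s ->
     CD_infty id e D s k ->
     forall lambda : R,
       first_nonzero_eigenvalue e D s lambda -> k <= lambda)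
  /\
  (forall s : V -> V -> 'M[R[i]]_d,
     signature e [pred A | A \is unitarymx] s ->
     CD_infty (@Num.conj R[i]) e D s k%:C ->
     forall lambda : R[i],
       first_nonzero_eigenvalue e D s lambda -> k%:C <= lambda).
Proof.
case: He => esym _; split=> s sH cd lambda [ev nz _].
- apply: (@conn_eigenvalue_lower_bound R idfun _ V e D d s) => //.
    move=> x y exy; have [/eqP oxy ->] := sH x y exy.
    by rewrite inE map_mx_id ?oxy.
  by move=> a; rewrite -expr2 sqr_ge0.
- apply: (@conn_eigenvalue_lower_bound _ (@Num.conj R[i]) _ V e D d s) => //.
  + exact: conjCK.
  + move=> x y exy; have [/unitarymxP uxy ->] := sH x y exy.
    by rewrite inE map_trmx uxy.
  + exact: mul_conjC_ge0.
Qed.
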